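(* Let $n\ge 1$ and let $\sigma$ be a uniformly random permutation in $\mathfrak{S}_n$. Then for every integer $k$ with $-(n-1)\le k\le n-1$, $$\mathbb{E}[d_k]=\frac{n-|k|}{n}.$$
   Context: $\mathfrak{S}_n$ is the set of permutations of $\{1,\dots,n\}$. For $\sigma\in\mathfrak{S}_n$, the displacement of the index $i$ is $\delta_i=i-\sigma(i)$, and the displacement counts are $d_k=|\{i\in\{1,\dots,n\}:\delta_i=k\}|$ for $-(n-1)\le k\le n-1$. *)

(* Defs.v *)
From HB Require Import structures.
From mathcomp Require Import all_boot all_order all_algebra all_fingroup.
From mathcomp Require Import all_classical all_reals all_analysis.

Set Implicit Arguments.
Unset Strict Implicit.
Unset Printing Implicit Defensive.

Import Order.TTheory GRing.Theory Num.Theory.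
Local Open Scope classical_set_scope.
Local Open Scope ring_scope.

(* ['S_n] permutes {0, ..., n-1} rather than {1, ..., n}; the common shift by 1
   cancels in [i - s i]. *)
Definition displacement (n : nat) (s : 'S_n) (i : 'I_n) : int :=
  (i : nat)%:Z - (s i : nat)%:Z.

Definition displacement_count (n : nat) (s : 'S_n) (k : int) : nat :=
  #|[set i : 'I_n | displacement s i == k]%SET|.

(* [S] carries no sigma-algebra of its own: it is viewed as discrete, so that
   measurability of [X] amounts to measurability of its finitely many fibres. *)
Definition uniformly_random (d : measure_display) (T : measurableType d)
    (R : realType) (P : probability T R) (S : finType) (X : T -> S) : Prop :=
  forall s : S, measurable (X @^-1` [set s]) /\
    P (X @^-1` [set s]) = ((#|S|%:R)^-1)%:E.

(* Main.v *)
Require Import Defs.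
From HB Require Import structures.
From mathcomp Require Import all_boot all_order all_algebra all_fingroup.
From mathcomp Require Import all_classical all_reals all_analysis.
From mathcomp Require Import zify.

Set Implicit Arguments.
Unset Strict Implicit.
Unset Printing Implicit Defensive.

Import Order.TTheory GRing.Theory Num.Theory.
Local Open Scope ring_scope.

(** By linearity of expectation, [E[d_k]] is the sum of the probabilities of
    the events [sigma i = j] over the pairs [(i, j)] with [i - j = k].  Each of
    these probabilities is [1 / n], since a uniform permutation sends a given
    point to every point equally often ([card_perm_maps_to]), and there are
    [n - |k|] such pairs, the cells of a diagonal of an [n] by [n] board
    ([card_diagonal]).  As the expectation under a uniform law is an average
    ([expectation_uniform]), linearity becomes a double count of the triples
    [(sigma, i, j)] with [sigma i = j] and [i - j = k]
    ([sum_displacement_count]). *)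

(** Composing with the transposition of [j] and [j'] exchanges the permutations
    sending [i] to [j] with those sending [i] to [j'], so these classes, which
    partition all permutations, have the same size. *)
Lemma card_perm_maps_to (T : finType) (i j : T) :
  (#|T| * #|[set s : {perm T} | s i == j]%SET| = (#|T|)`!)%N.
Proof.
have same_size j' :
    #|[set s : {perm T} | s i == j']%SET| = #|[set s : {perm T} | s i == j]%SET|.
  rewrite -(card_imset _ (mulIg (tperm j j'))); apply: eq_card => s.
  apply/imsetP/idP => [[t]|]; rewrite inE => /eqP ti.
    by move=> ->; rewrite inE permM ti tpermR.
  exists (s * tperm j j')%g; first by rewrite inE permM ti tpermL.
  by rewrite -mulgA tperm2 mulg1.
have -> : (#|T|)`! = #|{: {perm T}}|.
  rewrite -cardsT -card_perm; apply: eq_card => s.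
  by rewrite inE; apply/fintype.subsetP => x _; rewrite inE.
rewrite -[RHS]sum1_card (partition_big (fun s : {perm T} => s i) xpredT) //=.
rewrite -sum_nat_const; apply: eq_bigr => j' _.
by rewrite -(same_size j') -sum1dep_card.
Qed.

(** On an [n] by [n] board, the diagonal at offset [m] is parametrized by its
    column, which runs over the first [n - m] indices. *)
Lemma card_lower_diagonal (n m : nat) :
  #|[set p : 'I_n * 'I_n | p.1 == (p.2 + m)%N :> nat]%SET| = (n - m)%N.
Proof.
have shift_lt (q : 'I_(n - m)) : (q + m < n)%N by have := ltn_ord q; lia.
pose cell q := (Ordinal (shift_lt q), widen_ord (leq_subr m n) q).
have cell_inj : injective cell.
  by move=> q q' /(congr1 (fun p => val p.2)) qq'; apply: val_inj.
rewrite -[RHS]card_ord -cardsT -(card_imset _ cell_inj).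
apply: eq_card => -[i j]; apply/idP/imsetP => [|[q _ ->]]; rewrite inE //=.
move/eqP => ij; have j_lt : (j < n - m)%N by have := ltn_ord i; lia.
by exists (Ordinal j_lt) => //; congr pair; apply: val_inj.
Qed.

(** Reflecting the board in its main diagonal negates the offset, which reduces
    the case [k < 0] to the case [0 < k]. *)
Lemma card_diagonal (n : nat) (k : int) :
  #|[set p : 'I_n * 'I_n | p.1%:Z - p.2%:Z == k]%SET| = (n - `|k|)%N.
Proof.
rewrite -card_lower_diagonal; case: (leP 0 k) => k0.
  by apply: eq_card => -[i j]; rewrite !inE /=; apply/eqP/eqP; lia.
pose swap (p : 'I_n * 'I_n) := (p.2, p.1).
have swapK : involutive swap by case.
rewrite -[RHS](card_imset _ (inv_inj swapK)); apply: eq_card => -[i j].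
apply/idP/imsetP => [|[[i' j'] + [-> ->]]]; rewrite !inE /= => /eqP ij.
  by exists (j, i); rewrite // inE /=; apply/eqP; lia.
by apply/eqP; lia.
Qed.

(** A double count of the triples [(s, i, j)] with [s i = j] and [i - j = k]:
    by cells of the diagonal instead of by permutations.  The factor [n] on the
    left keeps the identity free of division and of [n.-1`!]. *)
Lemma sum_displacement_count (n : nat) (k : int) :
  (n * \sum_(s : 'S_n) displacement_count s k = n`! * (n - `|k|))%N.
Proof.
pose D := [set p : 'I_n * 'I_n | p.1%:Z - p.2%:Z == k]%SET.
(* The indices of displacement k are the cells of the diagonal D that lie on
   the graph of s. *)
have count_graph (s : 'S_n) :
    displacement_count s k = (\sum_(p in D) (s p.1 == p.2))%N.
  rewrite /displacement_count -sum1dep_card [LHS]big_mkcond [RHS]big_mkcond /=.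
  transitivity (\sum_i \sum_j if (i, j) \in D then (s i == j : nat) else 0)%N.
    apply: eq_bigr => i _; rewrite (bigD1 (s i)) //= big1 => [|j /negPf].
      by rewrite addn0 inE eqxx.
    by rewrite eq_sym => ->; case: ifP.
  by rewrite pair_bigA; apply: eq_bigr => -[].
under eq_bigr do rewrite count_graph.
rewrite exchange_big big_distrr /= -card_diagonal mulnC -sum_nat_const.
apply: eq_bigr => p _; rewrite -[in RHS](card_ord n) -(card_perm_maps_to p.1 p.2).
by rewrite card_ord -sum1dep_card [in RHS]big_mkcond.
Qed.

(** A function of a uniform [X] is a finite combination of indicators of the
    fibres of [X], each of which has probability [1 / #|S|]. *)
Lemma expectation_uniform (d : measure_display) (T : measurableType d)
    (R : realType) (P : probability T R) (S : finType) (X : T -> S)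
    (f : S -> R) :
  uniformly_random P X ->
  ('E_P[f \o X] = ((\sum_s f s) / #|S|%:R)%:E)%E.
Proof.
move=> X_unif; rewrite unlock.
have fX_indic w : ((f \o X) w)%:E =
    (\sum_s (f s)%:E * (\1_(X @^-1` [set s]) w)%:E)%E.
  rewrite (bigD1 (X w)) //= big1 ?adde0 => [|s /eqP sX].
    by rewrite indicE mem_set // mule1.
  by rewrite indicE memNset ?mule0 // => /esym.
have int_fibre s : P.-integrable setT
    (fun w => (\1_(X @^-1` [set s]) w : R)%:E).
  by apply: integrable_indic => //; case: (X_unif s).
under eq_integral do rewrite fX_indic.
rewrite integral_sum //; last by move=> s; apply: integrableZl.
rewrite mulr_suml -sumEFin; apply: eq_bigr => s _.
have [mfibre Pfibre] := X_unif s.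
rewrite integralZl // integral_indic // setIT.
by rewrite EFinM; congr (_ * _)%E; exact: Pfibre.
Qed.

Theorem proposition2p4 (n : nat) (n_ge1 : (1 <= n)%N)
    (R : realType) (d : measure_display) (T : measurableType d)
    (P : probability T R) (sigma : T -> 'S_n)
    (sigma_unif : uniformly_random P sigma)
    (k : int) (k_range : - (n%:Z - 1) <= k <= n%:Z - 1) :
  ('E_P[fun w => (displacement_count (sigma w) k)%:R]
    = ((n%:R - `|k|%:~R) / n%:R)%:E)%E.
Proof.
rewrite (expectation_uniform (fun s => (displacement_count s k)%:R) sigma_unif).
congr (_%:E); rewrite card_Sn -natr_sum.
have n_neq0 : n%:R != 0 :> R by rewrite pnatr_eq0; lia.
have fact_neq0 : n`!%:R != 0 :> R by rewrite pnatr_eq0 -lt0n fact_gt0.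
have k_le : (`|k| <= n)%N by lia.
have -> : n%:R - `|k|%:~R = (n - `|k|)%N%:R :> R.
  by rewrite natrB // -abszE.
apply/eqP; rewrite eqr_div // -!natrM mulnC sum_displacement_count.
by rewrite mulnC.
Qed.
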